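(* There exists a topologically convex polyhedron, all of whose faces are acute isosceles triangles, that has no one-piece edge unfolding.
   Context: A polyhedron is a compact subset of $\mathbb{R}^3$ whose boundary surface is a closed embedded surface made of finitely many planar polygonal faces meeting edge-to-edge. It is topologically convex if its surface is homeomorphic to a sphere and its graph of vertices and edges is a 3-vertex-connected planar graph, i.e. it is combinatorially equivalent to a convex polyhedron. An edge unfolding is specified by a set of edges (the cut edges). Cutting the surface along them separates it into connected pieces. The unfolding is valid if each piece can be laid out isometrically in the plane, face by face, as a simple (non-self-overlapping) polygon. A one-piece edge unfolding is a valid edge unfolding with exactly one piece. *)

(* Defs.v *)
From mathcomp Require Import all_boot.
From Stdlib Require Import Reals Relations.
Local Open Scope R_scope.

Set Implicit Arguments.
Unset Strict Implicit.
Unset Printing Implicit Defensive.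

Record pt3 := Pt3 { px : R; py : R; pz : R }.
Record pt2 := Pt2 { qx : R; qy : R }.

Definition sub3 (a b : pt3) : pt3 := Pt3 (px a - px b) (py a - py b) (pz a - pz b).
Definition dot3 (a b : pt3) : R := (px a * px b + py a * py b + pz a * pz b).
Definition cross3 (a b : pt3) : pt3 :=
  Pt3 (py a * pz b - pz a * py b) (pz a * px b - px a * pz b)
      (px a * py b - py a * px b).
Definition dist3sq (a b : pt3) : R := dot3 (sub3 a b) (sub3 a b).
Definition dist2sq (a b : pt2) : R :=
  ((qx a - qx b) * (qx a - qx b) + (qy a - qy b) * (qy a - qy b)).

Definition i0 : 'I_3 := @Ordinal 3 0 isT.
Definition i1 : 'I_3 := @Ordinal 3 1 isT.
Definition i2 : 'I_3 := @Ordinal 3 2 isT.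

Definition bary (w : 'I_3 -> R) : Prop :=
  (0 <= w i0) /\ (0 <= w i1) /\ (0 <= w i2) /\ (w i0 + w i1 + w i2 = 1).

Definition comb3 (w : 'I_3 -> R) (p : 'I_3 -> pt3) : pt3 :=
  Pt3 (w i0 * px (p i0) + w i1 * px (p i1) + w i2 * px (p i2))
      (w i0 * py (p i0) + w i1 * py (p i1) + w i2 * py (p i2))
      (w i0 * pz (p i0) + w i1 * pz (p i1) + w i2 * pz (p i2)).
Definition comb2 (w : 'I_3 -> R) (p : 'I_3 -> pt2) : pt2 :=
  Pt2 (w i0 * qx (p i0) + w i1 * qx (p i1) + w i2 * qx (p i2))
      (w i0 * qy (p i0) + w i1 * qy (p i1) + w i2 * qy (p i2)).

Definition on_seg (x a b : pt3) : Prop :=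
  exists t : R, (0 <= t <= 1) /\
    x = Pt3 ((1 - t) * px a + t * px b) ((1 - t) * py a + t * py b)
            ((1 - t) * pz a + t * pz b).

Record tri_surface := TriSurface {
  nV : nat;
  nF : nat;
  vpos : 'I_nV -> pt3;
  fvert : 'I_nF -> 'I_3 -> 'I_nV
}.

Section Surface.
Variable S : tri_surface.

Definition fpos (f : 'I_(nF S)) (i : 'I_3) : pt3 := vpos (fvert f i).

Definition in_face (v : 'I_(nV S)) (f : 'I_(nF S)) : bool :=
  [exists i, fvert f i == v].

Definition is_edge (u v : 'I_(nV S)) : bool :=
  (u != v) && [exists f, in_face u f && in_face v f].

Definition num_edges : nat :=
  #|[set p : 'I_(nV S) * 'I_(nV S) | (p.1 < p.2)%nat && is_edge p.1 p.2]|.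

Definition face_normal (f : 'I_(nF S)) : pt3 :=
  cross3 (sub3 (fpos f i1) (fpos f i0)) (sub3 (fpos f i2) (fpos f i0)).

Definition connected_avoiding (a b : 'I_(nV S)) : Prop :=
  forall u v, u <> a -> u <> b -> v <> a -> v <> b ->
    clos_refl_trans _ (fun x y => is_edge x y /\ x <> a /\ x <> b /\ y <> a /\ y <> b) u v.

(* The surface is a closed polyhedral surface embedded in R^3, with
   triangular faces meeting edge-to-edge, homeomorphic to a sphere
   (combinatorial 2-manifold, connected, Euler characteristic 2), whose
   faces are genuinely the planar faces (adjacent triangles not
   coplanar), and whose graph is 3-vertex-connected. *)
Definition topologically_convex : Prop :=
  injective (@vpos S) /\
  (forall f : 'I_(nF S), injective (@fvert S f)) /\
  (forall f, face_normal f <> Pt3 0 0 0) /\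
  (forall f g, (forall v, in_face v f = in_face v g) -> f = g) /\
  (forall v, exists f, in_face v f) /\
  (forall u v, is_edge u v ->
     exists f g, f <> g /\ in_face u f /\ in_face v f /\ in_face u g /\ in_face v g /\
       forall h, in_face u h -> in_face v h -> h = f \/ h = g) /\
  (* embedded, faces meet edge-to-edge: two distinct faces intersect
     exactly in the convex hull of their common vertices *)
  (forall f g (w w' : 'I_3 -> R), f <> g -> bary w -> bary w' ->
     comb3 w (fpos f) = comb3 w' (fpos g) ->
     forall i, ~~ in_face (fvert f i) g -> w i = 0) /\
  (* faces sharing an edge are not coplanar (so the triangles are faces) *)
  (forall f g i,
     f <> g -> ~~ in_face (fvert g i) f ->
     (exists u v, u <> v /\ in_face u f /\ in_face v f /\ in_face u g /\ in_face v g) ->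
     dot3 (face_normal f) (sub3 (fpos g i) (fpos f i0)) <> 0) /\
  (* vertex links are single cycles *)
  (forall v f g, in_face v f -> in_face v g ->
     clos_refl_trans _ (fun h k => in_face v h /\ in_face v k /\
                          exists u, u <> v /\ in_face u h /\ in_face u k) f g) /\
  (nV S + nF S = num_edges + 2)%nat /\
  (4 <= nV S)%nat /\
  (forall a b, connected_avoiding a b).

Definition acute_isosceles (f : 'I_(nF S)) : Prop :=
  let a := fpos f i0 in let b := fpos f i1 in let c := fpos f i2 in
  (dist3sq a b = dist3sq a c \/ dist3sq b a = dist3sq b c \/ dist3sq c a = dist3sq c b) /\
  (0 < dot3 (sub3 b a) (sub3 c a)) /\
  (0 < dot3 (sub3 a b) (sub3 c b)) /\
  (0 < dot3 (sub3 a c) (sub3 b c)).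

Variable cut : 'I_(nV S) -> 'I_(nV S) -> bool.
Definition is_cut (u v : 'I_(nV S)) : Prop := is_edge u v /\ (cut u v || cut v u).
Definition uncut (u v : 'I_(nV S)) : Prop := is_edge u v /\ ~~ (cut u v || cut v u).

Definition glued (f g : 'I_(nF S)) : Prop :=
  exists u v, uncut u v /\ in_face u f /\ in_face v f /\ in_face u g /\ in_face v g.

Definition glued_at (x : pt3) (f g : 'I_(nF S)) : Prop :=
  exists u v, uncut u v /\ in_face u f /\ in_face v f /\ in_face u g /\ in_face v g /\
    on_seg x (vpos u) (vpos v).

(* (f, x) and (g, x) represent the same point of the cut surface *)
Definition same_cut_point (x : pt3) (f g : 'I_(nF S)) : Prop :=
  clos_refl_trans _ (glued_at x) f g.

Variable lay : 'I_(nF S) -> 'I_3 -> pt2.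

Definition layout_isometric : Prop :=
  forall f i j, dist2sq (lay f i) (lay f j) = dist3sq (fpos f i) (fpos f j).

Definition layout_glued : Prop :=
  forall f g i i' j j', i <> i' ->
    fvert f i = fvert g j -> fvert f i' = fvert g j' ->
    uncut (fvert f i) (fvert f i') -> lay f i = lay g j.

Definition layout_injective : Prop :=
  forall f g (w w' : 'I_3 -> R), bary w -> bary w' ->
    comb2 w (lay f) = comb2 w' (lay g) ->
    comb3 w (fpos f) = comb3 w' (fpos g) /\
    same_cut_point (comb3 w (fpos f)) f g.

End Surface.

(* A one-piece edge unfolding: the cut surface is a single piece
   (faces connected through uncut edges), laid out isometrically face by
   face in the plane without overlap as a simple polygon (a disk without
   holes: the boundary, traced by the cut edges, is one closed curve,
   i.e. the cut edges form a nonempty connected subgraph). *)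
Definition one_piece_edge_unfolding (S : tri_surface)
    (cut : 'I_(nV S) -> 'I_(nV S) -> bool) (lay : 'I_(nF S) -> 'I_3 -> pt2) : Prop :=
  (forall f g, clos_refl_trans _ (glued cut) f g) /\
  (exists u v, is_cut cut u v) /\
  (forall u v u' v', is_cut cut u v -> is_cut cut u' v' ->
     clos_refl_trans _ (is_cut cut) u u') /\
  layout_isometric lay /\
  layout_glued cut lay /\
  layout_injective cut lay.

Definition has_one_piece_edge_unfolding (S : tri_surface) : Prop :=
  exists cut lay, @one_piece_edge_unfolding S cut lay.

(* Main.v *)
Require Import Defs.
From Stdlib Require Import Reals Relations ZArith Lra Lia.
From mathcomp Require Import all_boot.

Set Implicit Arguments.
Unset Strict Implicit.
Unset Printing Implicit Defensive.

(** The polyhedron is a regular tetrahedron each of whose faces is replaced by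
    a hat of nine triangles: a spike with apex [a] and base [x y z], and a ring
    of six triangles joining [x y z] to the corners [A B C] of the face.  It has
    36 faces and 54 edges.  Since the faces stay connected, at least 35 edges are
    uncut, hence at most 19 are cut and some hat has at most 4 of its 12 own
    edges cut.  In that hat the apex (positive curvature) meets at least one cut
    and each of [x y z] (negative curvature) at least two, for otherwise the
    faces around the vertex overlap or fail to close up; and since the cuts are
    connected, one of them reaches a corner.  With at most 4 cut edges these must
    form a path [a], [x], [y], [z], corner, up to symmetry.  Unfolding along such
    a path makes two faces overlap: the last edge [x a] of the unrolled spike
    crosses [y z]. *)

(** * Triangles in the plane *)

Section Plane.
Local Open Scope R_scope.

Definition area2 (u v w : pt2) : R :=
  (qx v - qx u) * (qy w - qy u) - (qy v - qy u) * (qx w - qx u).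

Lemma area2_rot (u v w : pt2) : area2 v w u = area2 u v w.
Proof. rewrite /area2; ring. Qed.

Lemma area2_swap (u v w : pt2) : area2 u w v = - area2 u v w.
Proof. rewrite /area2; ring. Qed.

(** Heron's formula in squared side lengths; [area2] is twice the signed area. *)
Lemma heron (u v w : pt2) (p q r : R) :
  dist2sq u v = p -> dist2sq u w = q -> dist2sq v w = r ->
  4 * (area2 u v w * area2 u v w) = 4 * p * q - (p + q - r) * (p + q - r).
Proof. rewrite /dist2sq /area2 => <- <- <-; ring. Qed.

(* [placed s p q r K x v w]: the triangle [x v w] has squared sides
   [p = |xv|^2], [q = |xw|^2], [r = |vw|^2] and oriented area [s * K / 4], so
   that [w - x] is a fixed complex multiple of [v - x]. *)
Definition placed (s p q r K : R) (x v w : pt2) : Prop :=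
  2 * p * (qx w - qx x) = (p + q - r) * (qx v - qx x) - s * K * (qy v - qy x) /\
  2 * p * (qy w - qy x) = (p + q - r) * (qy v - qy x) + s * K * (qx v - qx x).

(** By [heron] and the sign condition, [s * K] is twice the cross product of [v - x] and [w - x],
    while [p + q - r] is twice their dot product. Both equations then expand [w - x] in the
    orthogonal basis made of [v - x] and its quarter turn. *)
Lemma placed_of_dist (s p q r K : R) (x v w : pt2) :
  s = 1 \/ s = -1 -> 0 < K -> K * K = 4 * p * q - (p + q - r) * (p + q - r) ->
  dist2sq x v = p -> dist2sq x w = q -> dist2sq v w = r ->
  0 < s * area2 x v w -> placed s p q r K x v w.
Proof.
move=> hs K0 hK hp hq hr hpos.
have h := heron hp hq hr.
have e : s * K = 2 * area2 x v w by case: hs hpos => -> hpos; nra.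
rewrite /placed e; move: hp hq hr; rewrite /dist2sq /area2 => <- <- <-.
by split; ring.
Qed.

Lemma area2_sign (p q r K : R) (x v w : pt2) :
  0 < K -> K * K = 4 * p * q - (p + q - r) * (p + q - r) ->
  dist2sq x v = p -> dist2sq x w = q -> dist2sq v w = r ->
  area2 x v w <> 0.
Proof. by move=> K0 hK hp hq hr h0; have := heron hp hq hr; rewrite h0; nra. Qed.

(* Near the middle of their common side, two triangles on the same side of it
   overlap. *)
Lemma same_side_overlap (u v w w' : pt2) :
  0 < area2 u v w * area2 u v w' ->
  exists a b c a' b' c' : R,
    [/\ [/\ 0 <= a, 0 <= b, 0 < c & a + b + c = 1],
        [/\ 0 <= a', 0 <= b', 0 <= c' & a' + b' + c' = 1],
        a * qx u + b * qx v + c * qx w = a' * qx u + b' * qx v + c' * qx w' &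
        a * qy u + b * qy v + c * qy w = a' * qy u + b' * qy v + c' * qy w'].
Proof.
pose D := dist2sq u v.
(* [dt p / D] locates the foot of the perpendicular from [p] on the line [u v]. *)
pose dt (p : pt2) :=
  (qx v - qx u) * (qx p - qx u) + (qy v - qy u) * (qy p - qy u).
move=> hpos.
have D0 : 0 < D.
  have : D <> 0.
    move=> D0; have [h1 h2] : qx u - qx v = 0 /\ qy u - qy v = 0.
      by apply: Rplus_sqr_eq_0; rewrite /Rsqr.
    have h3 : area2 u v w = 0.
      rewrite /area2; have -> : qx v = qx u by lra.
      by have -> : qy v = qy u; [lra | ring].
    by rewrite h3 in hpos; lra.
  have : 0 <= D by apply: Rplus_le_le_0_compat; apply: Rle_0_sqr.
  by lra.
have bnd (m : R) : exists e0, 0 < e0 /\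
    forall e, 0 <= e <= e0 -> - (1 / 2) <= e * m <= 1 / 2.
  exists (1 / (2 * (1 + Rabs m))).
  have hm := Rabs_pos m.
  split; first by apply: Rdiv_lt_0_compat; lra.
  move=> e [h0 he].
  have h : e * Rabs m <= 1 / 2.
    have : e * (2 * (1 + Rabs m)) <= 1 / (2 * (1 + Rabs m)) * (2 * (1 + Rabs m)).
      by apply: Rmult_le_compat_r; lra.
    have -> : 1 / (2 * (1 + Rabs m)) * (2 * (1 + Rabs m)) = 1 by field; lra.
    by nra.
  by move: h; rewrite /Rabs; case: Rcase_abs => ? ?; nra.
have gen (s : R) : 0 < s * area2 u v w -> 0 < s * area2 u v w' ->
    exists a b c a' b' c' : R,
    [/\ [/\ 0 <= a, 0 <= b, 0 < c & a + b + c = 1],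
        [/\ 0 <= a', 0 <= b', 0 <= c' & a' + b' + c' = 1],
        a * qx u + b * qx v + c * qx w = a' * qx u + b' * qx v + c' * qx w' &
        a * qy u + b * qy v + c * qy w = a' * qy u + b' * qy v + c' * qy w'].
  move=> h h'.
  set k := s * area2 u v w' in h'; set k' := s * area2 u v w in h.
  have [e1 [? H1]] := bnd (k * (dt w / D)).
  have [e2 [? H2]] := bnd (k * (1 - dt w / D)).
  have [e3 [? H3]] := bnd (k' * (dt w' / D)).
  have [e4 [? H4]] := bnd (k' * (1 - dt w' / D)).
  pose e := Rmin (Rmin e1 e2) (Rmin e3 e4).
  have he : 0 < e by rewrite /e; do ! apply: Rmin_glb_lt.
  have l1 := Rmin_l (Rmin e1 e2) (Rmin e3 e4).
  have l2 := Rmin_r (Rmin e1 e2) (Rmin e3 e4).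
  have l3 := Rmin_l e1 e2; have l4 := Rmin_r e1 e2.
  have l5 := Rmin_l e3 e4; have l6 := Rmin_r e3 e4.
  rewrite -/e in l1 l2.
  have {}H1 := H1 e ltac:(lra); have {}H2 := H2 e ltac:(lra).
  have {}H3 := H3 e ltac:(lra); have {}H4 := H4 e ltac:(lra).
  (* The weights on [u] and [v] make both points project onto the midpoint of [u v]. The weights
     [e * k] and [e * k'] are crossed, each built from the area of the other triangle, so that both
     points have the same height above [u v]. A small [e] keeps all weights nonnegative. *)
  exists (1 / 2 - e * (k * (1 - dt w / D))), (1 / 2 - e * (k * (dt w / D))), (e * k),
    (1 / 2 - e * (k' * (1 - dt w' / D))), (1 / 2 - e * (k' * (dt w' / D))), (e * k').
  have hk : 0 < e * k by apply: Rmult_lt_0_compat.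
  have hk' : 0 < e * k' by apply: Rmult_lt_0_compat.
  have D1 : D <> 0 by lra.
  split; [split=> //; try lra; ring | split=> //; try lra; ring | |].
    apply: (Rmult_eq_reg_r D) => //; rewrite /k /k' /dt /area2.
    move: D1; rewrite /D /dist2sq => D1; field => //.
  apply: (Rmult_eq_reg_r D) => //; rewrite /k /k' /dt /area2.
  move: D1; rewrite /D /dist2sq => D1; field => //.
have [h|h] : 0 < area2 u v w \/ area2 u v w < 0.
- case: (Rtotal_order (area2 u v w) 0) => [|[h0|]]; [by right | | by left].
  by move: hpos; rewrite h0; lra.
- by apply: (gen 1); nra.
- by apply: (gen (-1)); nra.
Qed.

End Plane.

(** * Developing faces around a vertex *)

Section Layout.
Local Open Scope R_scope.
Variable S : tri_surface.
Implicit Types (f g : 'I_(nF S)) (u v w x t : 'I_(nV S)).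

Definition is_tri f u v w : bool :=
  [&& u != v, v != w, u != w, in_face u f, in_face v f & in_face w f].

Definition tri u v w : Prop := exists f, is_tri f u v w.

Lemma is_tri_rot f u v w : is_tri f u v w -> is_tri f v w u.
Proof.
case/and5P=> uv vw uw fu /andP[fv fw].
by rewrite /is_tri vw fv fw fu (eq_sym w) (eq_sym v) uv uw.
Qed.

Lemma is_tri_swap f u v w : is_tri f u v w -> is_tri f u w v.
Proof.
case/and5P=> uv vw uw fu /andP[fv fw].
by rewrite /is_tri uw fv fw fu (eq_sym w) uv vw.
Qed.

Lemma tri_rot u v w : tri u v w -> tri v w u.
Proof. by case=> f /is_tri_rot; exists f. Qed.

Lemma tri_swap u v w : tri u v w -> tri u w v.
Proof. by case=> f /is_tri_swap; exists f. Qed.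

(** The default [i0] is a junk value for [v] outside [f]. *)
Definition corner f v : 'I_3 := odflt i0 [pick i | fvert f i == v].

Lemma cornerK f v : in_face v f -> fvert f (corner f v) = v.
Proof.
case/existsP=> i fi; rewrite /corner; case: pickP => [j /eqP //|].
by move/(_ i); rewrite fi.
Qed.

Lemma ord3P (i : 'I_3) : [\/ i = i0, i = i1 | i = i2].
Proof.
case: i => [[|[|[|//]]] h]; [constructor 1|constructor 2|constructor 3];
  exact: val_inj.
Qed.

Lemma corner_tri f u v w (i : 'I_3) : is_tri f u v w ->
  [\/ i = corner f u, i = corner f v | i = corner f w].
Proof.
case/and5P=> /eqP uv /eqP vw /eqP uw fu /andP[fv fw].
have := cornerK fu; have := cornerK fv; have := cornerK fw.
case: (ord3P (corner f u)) => ->; case: (ord3P (corner f v)) => ->;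
case: (ord3P (corner f w)) => -> hw hv hu; try by case: uv; congruence.
all: try by case: vw; congruence.
all: try by case: uw; congruence.
all: by case: (ord3P i) => ->; by [constructor 1|constructor 2|constructor 3].
Qed.

Lemma is_tri_mem f u v w t : is_tri f u v w -> in_face t f ->
  [\/ t = u, t = v | t = w].
Proof.
move=> h ft; have [_ _ _ fu /andP[fv fw]] := and5P h.
case: (corner_tri (corner f t) h) => e;
  have := cornerK ft; rewrite e cornerK // => ->;
  by [constructor 1|constructor 2|constructor 3].
Qed.

Definition sqd u v : R := dist3sq (vpos u) (vpos v).

Lemma sqdC u v : sqd u v = sqd v u.
Proof. rewrite /sqd /dist3sq /dot3 /=; ring. Qed.

Variables (cut : 'I_(nV S) -> 'I_(nV S) -> bool).
Variable lay : 'I_(nF S) -> 'I_3 -> pt2.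

Definition lpos f v : pt2 := lay f (corner f v).

(** Passes from weights on named vertices to weights on corner indices. The weight at [w] is exposed
    because [no_overlap] contradicts embeddedness there. *)
Lemma tri_weights f u v w (a b c : R) :
  is_tri f u v w -> 0 <= a -> 0 <= b -> 0 <= c -> a + b + c = 1 ->
  exists wt : 'I_3 -> R,
    [/\ bary wt, wt (corner f w) = c,
        qx (comb2 wt (lay f)) =
          a * qx (lpos f u) + b * qx (lpos f v) + c * qx (lpos f w) &
        qy (comb2 wt (lay f)) =
          a * qy (lpos f u) + b * qy (lpos f v) + c * qy (lpos f w)].
Proof.
move=> /and5P[/eqP uv /eqP vw /eqP uw fu /andP[fv fw]] a0 b0 c0 abc.
exists (fun i => if i == corner f u then a else if i == corner f v then b else c).
rewrite /bary /lpos /comb2 /=.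
have := cornerK fu; have := cornerK fv; have := cornerK fw.
case: (ord3P (corner f u)) => ->; case: (ord3P (corner f v)) => ->;
case: (ord3P (corner f w)) => -> hw hv hu; try by case: uv; congruence.
all: try by case: vw; congruence.
all: try by case: uw; congruence.
all: by rewrite ?eqxx /=; repeat split => //=; lra.
Qed.

Hypothesis embedded :
  forall f g (wt wt' : 'I_3 -> R), f <> g -> bary wt -> bary wt' ->
    comb3 wt (fpos f) = comb3 wt' (fpos g) ->
    forall i, ~~ in_face (fvert f i) g -> wt i = 0.
Hypothesis isometric : layout_isometric lay.
Hypothesis glue : layout_glued cut lay.
Hypothesis lay_inj : layout_injective cut lay.

Lemma lpos_dist f u v : in_face u f -> in_face v f ->
  dist2sq (lpos f u) (lpos f v) = sqd u v.
Proof. by move=> fu fv; rewrite isometric /fpos !cornerK. Qed.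

Lemma lpos_glue f g u v : u != v -> in_face u f -> in_face v f ->
  in_face u g -> in_face v g -> uncut cut u v -> lpos f u = lpos g u.
Proof.
move=> /eqP uv fu fv gu gv huv.
apply: (@glue f g _ (corner f v) _ (corner g v)); rewrite ?cornerK //.
by move=> e; apply: uv; rewrite -(cornerK fu) e cornerK.
Qed.

(** A common point in the layout comes from a common point of [f] and [g] in space, by injectivity.
    Embeddedness then forces weight 0 on [w], which is not a vertex of [g]. *)
Lemma no_overlap f g u v w u' v' w' (a b c a' b' c' : R) :
  is_tri f u v w -> is_tri g u' v' w' -> ~~ in_face w g ->
  [/\ 0 <= a, 0 <= b, 0 < c & a + b + c = 1] ->
  [/\ 0 <= a', 0 <= b', 0 <= c' & a' + b' + c' = 1] ->
  a * qx (lpos f u) + b * qx (lpos f v) + c * qx (lpos f w) =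
    a' * qx (lpos g u') + b' * qx (lpos g v') + c' * qx (lpos g w') ->
  a * qy (lpos f u) + b * qy (lpos f v) + c * qy (lpos f w) =
    a' * qy (lpos g u') + b' * qy (lpos g v') + c' * qy (lpos g w') ->
  False.
Proof.
move=> hf hg wg [a0 b0 c0 abc] [a0' b0' c0' abc'] ex ey.
have [wt [hb hc hx hy]] := tri_weights hf a0 b0 (Rlt_le _ _ c0) abc.
have [wt' [hb' _ hx' hy']] := tri_weights hg a0' b0' c0' abc'.
have e : comb2 wt (lay f) = comb2 wt' (lay g).
  have eta (p : pt2) : p = Pt2 (qx p) (qy p) by case: p.
  by rewrite (eta (comb2 wt (lay f))) (eta (comb2 wt' (lay g))) hx hy hx' hy' ex ey.
have [e3 _] := lay_inj hb hb' e.
have fw : in_face w f by case/and5P: hf => _ _ _ _ /andP[].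
have fg : f <> g by move=> fg; rewrite fg in fw; rewrite fw in wg.
have := embedded fg hb hb' e3 (i := corner f w).
by rewrite cornerK // hc => /(_ wg); lra.
Qed.

Lemma is_tri_neq_mem f u v w w' : is_tri f u v w -> w' != u -> w' != v ->
  w' != w -> ~~ in_face w' f.
Proof.
move=> h n1 n2 n3; apply/negP=> /(is_tri_mem h).
by case=> e; move: n1 n2 n3; rewrite e eqxx.
Qed.

Lemma uncutC u v : uncut cut u v -> uncut cut v u.
Proof.
rewrite /uncut /is_edge eq_sym orbC => -[] /andP[-> /existsP[f fuv]] ->.
by split=> //; apply/existsP; exists f; rewrite andbC.
Qed.

(** Glued faces share the laid-out segment [u v]; on the same side of it they would overlap, by
    [same_side_overlap]. *)
Lemma opposite_sides f g u v w w' (s : R) :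
  is_tri f u v w -> is_tri g u v w' -> w != w' -> uncut cut u v ->
  0 < s * area2 (lpos f u) (lpos f v) (lpos f w) ->
  area2 (lpos g u) (lpos g v) (lpos g w') <> 0 ->
  s * area2 (lpos g u) (lpos g v) (lpos g w') < 0.
Proof.
move=> hf hg ww' huv hs hne.
have [uv vw uw fu /andP[fv fw]] := and5P hf.
have [_ vw' uw' gu /andP[gv gw']] := and5P hg.
have eu : lpos g u = lpos f u := lpos_glue uv gu gv fu fv huv.
have ev : lpos g v = lpos f v.
  by apply: (lpos_glue (v := u)) => //; [rewrite eq_sym | exact: uncutC].
have wg : ~~ in_face w g by apply: (is_tri_neq_mem hg); rewrite // eq_sym.
case: (Rtotal_order (s * area2 (lpos g u) (lpos g v) (lpos g w')) 0) => [//|h].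
have {}h : 0 < s * area2 (lpos g u) (lpos g v) (lpos g w').
  case: h => // h; have [s0|//] : s = 0 \/ area2 (lpos g u) (lpos g v) (lpos g w') = 0.
    exact: Rmult_integral.
  by move: hs; rewrite s0; lra.
rewrite eu ev in h.
have hp : 0 < area2 (lpos f u) (lpos f v) (lpos f w) *
              area2 (lpos f u) (lpos f v) (lpos g w').
  have : 0 < (s * area2 (lpos f u) (lpos f v) (lpos f w)) *
             (s * area2 (lpos f u) (lpos f v) (lpos g w')) by apply: Rmult_lt_0_compat.
  set A := area2 _ _ _; set B := area2 _ _ _ => AB.
  by case: (Rle_lt_dec (A * B) 0) => //; have := Rle_0_sqr s; rewrite /Rsqr; nra.
have [a [b [c [a' [b' [c' [h1 h2 ex ey]]]]]]] := same_side_overlap hp.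
by case: (no_overlap hf hg wg h1 h2); rewrite eu ev.
Qed.

(** The first face of a fan fixes the orientation [s], which [fan_step] carries along. *)
Lemma fan_start f x v w (p q r K : R) :
  is_tri f x v w -> 0 < K -> K * K = 4 * p * q - (p + q - r) * (p + q - r) ->
  sqd x v = p -> sqd x w = q -> sqd v w = r ->
  exists s, (s = 1 \/ s = -1) /\ 0 < s * area2 (lpos f x) (lpos f v) (lpos f w) /\
    placed s p q r K (lpos f x) (lpos f v) (lpos f w).
Proof.
move=> hf K0 hK hp hq hr; have [xv vw xw fx /andP[fv fw]] := and5P hf.
rewrite -(lpos_dist fx fv) in hp; rewrite -(lpos_dist fx fw) in hq.
rewrite -(lpos_dist fv fw) in hr.
have ne := area2_sign K0 hK hp hq hr.
case: (Rtotal_order (area2 (lpos f x) (lpos f v) (lpos f w)) 0) => [h|[//|h]].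
- exists (-1); do 2! (split; first by [right|lra]).
  by apply: placed_of_dist => //; [right|lra].
- exists 1; do 2! (split; first by [left|lra]).
  by apply: placed_of_dist => //; [left|lra].
Qed.

(** Crossing an uncut edge [x v] leads to the other side of it, so the fan keeps turning the same
    way around [x], and the distances determine the next vertex. *)
Lemma fan_step f g x u v w (s p q r K : R) :
  is_tri f x u v -> is_tri g x v w -> u != w -> uncut cut x v ->
  s = 1 \/ s = -1 -> 0 < s * area2 (lpos f x) (lpos f u) (lpos f v) ->
  0 < K -> K * K = 4 * p * q - (p + q - r) * (p + q - r) ->
  sqd x v = p -> sqd x w = q -> sqd v w = r ->
  [/\ lpos g x = lpos f x, lpos g v = lpos f v,
      0 < s * area2 (lpos g x) (lpos g v) (lpos g w) &
      placed s p q r K (lpos f x) (lpos f v) (lpos g w)].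
Proof.
move=> hf hg uw hxv hs hpos K0 hK hp hq hr.
have [xu uv _ fx /andP[fu fv]] := and5P hf.
have [xv vw xw gx /andP[gv gw]] := and5P hg.
have ex : lpos g x = lpos f x := lpos_glue xv gx gv fx fv hxv.
have ev : lpos g v = lpos f v.
  by apply: (lpos_glue (v := x)) => //; [rewrite eq_sym | exact: uncutC].
rewrite -(lpos_dist gx gv) in hp; rewrite -(lpos_dist gx gw) in hq.
rewrite -(lpos_dist gv gw) in hr.
have ne := area2_sign K0 hK hp hq hr.
have h : 0 < s * area2 (lpos g x) (lpos g v) (lpos g w).
  (* Reading [f] from the edge [x v] with third vertex [u] reverses its orientation, hence the sign
     [- s]. *)
  have := opposite_sides (s := - s) (is_tri_swap hf) hg uw hxv _ ne.
  rewrite (area2_swap _ (lpos f u)) => h.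
  suff : - s * area2 (lpos g x) (lpos g v) (lpos g w) < 0 by lra.
  by apply: h; lra.
by split=> //; rewrite -ex -ev; apply: placed_of_dist.
Qed.

End Layout.

(** * Cuts in a hat *)

Section Hat.
Local Open Scope R_scope.
Variable S : tri_surface.
Implicit Types (u v w : 'I_(nV S)) (a x y z A B C : 'I_(nV S)).

(* The spike [a; x, y, z] stands on a ring of six triangles spanned between
   [x y z] and the corners [A B C]; [x] is opposite to [A], and so on. *)
Record hat a x y z A B C : Prop := Hat {
  hat_uniq : uniq [:: a; x; y; z; A; B; C];
  hat_axy : tri a x y; hat_ayz : tri a y z; hat_azx : tri a z x;
  hat_zxB : tri z x B; hat_xBC : tri x B C; hat_xCy : tri x C y;
  hat_yCA : tri y C A; hat_yAz : tri y A z; hat_zAB : tri z A B;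
  sqd_ax : sqd a x = 36900; sqd_ay : sqd a y = 36900; sqd_az : sqd a z = 36900;
  sqd_xy : sqd x y = 1800; sqd_yz : sqd y z = 1800; sqd_zx : sqd z x = 1800;
  sqd_xB : sqd x B = 64532; sqd_xC : sqd x C = 64532;
  sqd_yC : sqd y C = 64532; sqd_yA : sqd y A = 64532;
  sqd_zA : sqd z A = 64532; sqd_zB : sqd z B = 64532;
  sqd_AB : sqd A B = 125000; sqd_BC : sqd B C = 125000; sqd_CA : sqd C A = 125000 }.

(** This rotation and the reflection [hat_flip] generate the six symmetries of a hat, so it is
    enough to study the vertex [x] and one path. *)
Lemma hat_rot a x y z A B C : hat a x y z A B C -> hat a y z x B C A.
Proof.
case=> hu *; split=> //; try by rewrite sqdC.
- rewrite -(perm_uniq (s1 := [:: a; x; y; z; A; B; C])) //.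
  by apply/permP=> P /=; rewrite -!plusE; lia.
all: first [by apply: tri_swap | by apply: tri_rot | by do 2! apply: tri_rot
  | by apply: tri_swap; apply: tri_rot | by apply: tri_swap; do 2! apply: tri_rot].
Qed.

Lemma hat_flip a x y z A B C : hat a x y z A B C -> hat a x z y A C B.
Proof.
case=> hu *; split=> //; try by rewrite sqdC.
- rewrite -(perm_uniq (s1 := [:: a; x; y; z; A; B; C])) //.
  by apply/permP=> P /=; rewrite -!plusE; lia.
all: first [by apply: tri_swap | by apply: tri_rot | by do 2! apply: tri_rot
  | by apply: tri_swap; apply: tri_rot | by apply: tri_swap; do 2! apply: tri_rot].
Qed.

Lemma tri_is_edge u v w : tri u v w -> is_edge u v :> bool.
Proof.
case=> f /and5P[uv _ _ fu /andP[fv _]]; rewrite /is_edge uv.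
by apply/existsP; exists f; rewrite fu.
Qed.

Variable cut : 'I_(nV S) -> 'I_(nV S) -> bool.
Variable lay : 'I_(nF S) -> 'I_3 -> pt2.

Definition cutb u v : bool := cut u v || cut v u.

Lemma cutbC u v : cutb u v = cutb v u.
Proof. by rewrite /cutb orbC. Qed.

Lemma tri_uncut u v w : tri u v w -> ~~ cutb u v -> uncut cut u v.
Proof. by move=> /tri_is_edge h ?; split. Qed.

Lemma tri_cut u v w : tri u v w -> cutb u v -> is_cut cut u v.
Proof. by move=> /tri_is_edge h ?; split. Qed.

Hypothesis embedded :
  forall (f g : 'I_(nF S)) (wt wt' : 'I_3 -> R), f <> g -> bary wt -> bary wt' ->
    comb3 wt (fpos f) = comb3 wt' (fpos g) ->
    forall i, ~~ in_face (fvert f i) g -> wt i = 0.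
Hypothesis isometric : layout_isometric lay.
Hypothesis glue : layout_glued cut lay.
Hypothesis lay_inj : layout_injective cut lay.

(** [K] is the positive root in Heron's formula, four times the area; it is an integer for every
    triangle of a hat. *)
Definition fan_tri x v w (p q r K : R) : Prop :=
  [/\ tri x v w, sqd x v = p, sqd x w = q, sqd v w = r &
      0 < K /\ K * K = 4 * p * q - (p + q - r) * (p + q - r)].

Lemma fan_triC x v w p q r K : fan_tri x v w p q r K -> fan_tri x w v q p r K.
Proof.
case=> t xv xw vw [K0 hK]; split=> //; [exact: tri_swap | by rewrite sqdC |].
by split=> //; lra.
Qed.

Let start x v w p q r K : fan_tri x v w p q r K ->
  exists f s, [/\ is_tri f x v w, s = 1 \/ s = -1,
    0 < s * area2 (lpos lay f x) (lpos lay f v) (lpos lay f w) &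
    placed s p q r K (lpos lay f x) (lpos lay f v) (lpos lay f w)].
Proof.
case=> [[f hf]] hp hq hr [K0 hK].
by have [s [? [? ?]]] := fan_start isometric hf K0 hK hp hq hr; exists f, s.
Qed.

Let step f x u v w (s p q r K : R) : is_tri f x u v -> fan_tri x v w p q r K ->
  u != w -> ~~ cutb x v -> s = 1 \/ s = -1 ->
  0 < s * area2 (lpos lay f x) (lpos lay f u) (lpos lay f v) ->
  exists g, [/\ is_tri g x v w, lpos lay g x = lpos lay f x,
    lpos lay g v = lpos lay f v,
    0 < s * area2 (lpos lay g x) (lpos lay g v) (lpos lay g w) &
    placed s p q r K (lpos lay f x) (lpos lay f v) (lpos lay g w)].
Proof.
move=> hf [[g hg] hp hq hr [K0 hK]] uw cxv hs o.
have hxv : uncut cut x v by apply: tri_uncut cxv; exists g; exact: hg.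
have [? ? ? ?] := fan_step embedded isometric glue lay_inj hf hg uw hxv hs o K0 hK hp hq hr.
by exists g.
Qed.

Lemma fan_apex a x y z A B C : hat a x y z A B C ->
  fan_tri a x y 36900 36900 1800 16200.
Proof. by move=> h; split; first [by case: h | by split; lra]. Qed.

Lemma fan_spike a x y z A B C : hat a x y z A B C ->
  fan_tri x a z 36900 1800 36900 16200.
Proof.
move=> h; split; last (by split; lra); try by [case: h | rewrite sqdC; case: h].
by apply: tri_rot; apply: tri_rot; case: h.
Qed.

Lemma fan_cap a x y z A B C : hat a x y z A B C ->
  fan_tri x z B 1800 64532 64532 21480.
Proof.
move=> h; split; last (by split; lra); try by [case: h | rewrite sqdC; case: h].
by apply: tri_swap; apply: tri_rot; case: h.
Qed.

Lemma fan_base a x y z A B C : hat a x y z A B C ->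
  fan_tri x B C 64532 64532 125000 129000.
Proof. by move=> h; split; first [by case: h | by split; lra]. Qed.

(* When the angles around [x] add up to more than a full turn, a single cut
   edge [x w0] does not suffice: the last edge of the fan, a second copy
   [x w5] of [x w0], reenters the first triangle [x w0 w1]. *)
Lemma fan5_overlap x w0 w1 w2 w3 w4
    (p0 p1 p2 p3 p4 r0 r1 r2 r3 r4 K0 K1 K2 K3 K4 e c0 c1 : R) :
  uniq [:: w0; w1; w2; w3; w4] ->
  fan_tri x w0 w1 p0 p1 r0 K0 -> fan_tri x w1 w2 p1 p2 r1 K1 ->
  fan_tri x w2 w3 p2 p3 r2 K2 -> fan_tri x w3 w4 p3 p4 r3 K3 ->
  fan_tri x w4 w0 p4 p0 r4 K4 ->
  ~~ cutb x w1 -> ~~ cutb x w2 -> ~~ cutb x w3 -> ~~ cutb x w4 ->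
  [/\ 0 <= e <= 1, 0 <= c0, 0 < c1 & c0 + c1 <= 1] ->
  (forall s (u v0 v1 v2 v3 v4 v5 : pt2), s = 1 \/ s = -1 ->
     placed s p0 p1 r0 K0 u v0 v1 -> placed s p1 p2 r1 K1 u v1 v2 ->
     placed s p2 p3 r2 K2 u v2 v3 -> placed s p3 p4 r3 K3 u v3 v4 ->
     placed s p4 p0 r4 K4 u v4 v5 ->
     e * (qx v5 - qx u) = c0 * (qx v0 - qx u) + c1 * (qx v1 - qx u) /\
     e * (qy v5 - qy u) = c0 * (qy v0 - qy u) + c1 * (qy v1 - qy u)) ->
  False.
Proof.
move=> hu; have := hu; rewrite /= !inE => /and4P[].
move=> /norP[n01 /norP[n02 /norP[n03 n04]]] /norP[n12 /norP[n13 n14]].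
move=> /norP[n23 n24] /andP[n34 _] t0 t1 t2 t3 t4 u1 u2 u3 u4 [he c0p c1p c01] hplace.
have [f0 [s [h0 hs o0 q0]]] := start t0.
have [f1 [h1 x1 v1 o1 q1]] := step h0 t1 n02 u1 hs o0.
have [f2 [h2 x2 v2 o2 q2]] := step h1 t2 n13 u2 hs o1.
have [f3 [h3 x3 v3 o3 q3]] := step h2 t3 n24 u3 hs o2.
have [f4 [h4 x4 v4 o4 q4]] := step h3 t4 ltac:(by rewrite eq_sym) u4 hs o3.
rewrite x3 x2 x1 in q4 x4; rewrite x2 x1 in q3; rewrite x1 in q2.
have [ex ey] := hplace _ _ _ _ _ _ _ _ hs q0 q1 q2 q3 q4.
have [_ _ xw1 _ _] := and5P h0.
have [xw4 _ _ _ _] := and5P h4.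
(* The point at parameter [e] on the edge [x w5] of the last face lies in the first triangle with
   weight [c1 > 0] on [w1], and [w1] is not a vertex of the last face. *)
apply: (no_overlap embedded lay_inj (a := 1 - c0 - c1) (b := c0) (c := c1)
  (a' := 1 - e) (b' := 0) (c' := e) h0 h4).
- by apply: (is_tri_neq_mem h4); rewrite // eq_sym.
- by split=> //; lra.
- by split=> //; lra.
- by rewrite x4; lra.
- by rewrite x4; lra.
Qed.

(* A spike with no cut at its apex would close up in the plane, but its three
   apex angles sum to less than a full turn. *)
Lemma hat_apex_cut a x y z A B C : hat a x y z A B C ->
  [|| cutb a x, cutb a y | cutb a z].
Proof.
move=> h; apply: contraT => /norP[ux /norP[uy uz]].
have := hat_uniq h; rewrite /= !inE !negb_or.
move=> /andP[_ /andP[/and5P[xy xz _ _ _] _]].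
have [f1 [s [t1 hs o1 p1]]] := start (fan_apex h).
have [f2 [t2 a2 y2 o2 p2]] := step t1 (fan_apex (hat_rot h)) xz uy hs o1.
have [f3 [t3 a3 z3 o3 p3]] :=
  step t2 (fan_apex (hat_rot (hat_rot h))) ltac:(by rewrite eq_sym) uz hs o2.
have [az zx _ f3a /andP[f3z f3x]] := and5P t3.
have [ax _ _ f1a /andP[f1x f1y]] := and5P t1.
(* The edge [a x] is uncut as well, so the third face is glued back to the first. *)
have e4 : lpos lay f3 x = lpos lay f1 x.
  apply: (lpos_glue glue (v := a)) => //; first by rewrite eq_sym.
  exact/uncutC/(tri_uncut (hat_axy h)).
have := lpos_dist isometric f1a f1x; rewrite (sqd_ax h).
rewrite a2 e4 in p3; move: p1 p2 p3; rewrite /placed /dist2sq => p1 p2 p3.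
(* Three rotations by the apex angle compose to a nontrivial rotation, so a vector that it fixes is
   0; but [a x] has squared length 36900. *)
have [-> ->] : qx (lpos lay f1 x) = qx (lpos lay f1 a) /\
               qy (lpos lay f1 x) = qy (lpos lay f1 a).
  by case: hs p1 p2 p3 => -> [? ?] [? ?] [? ?]; lra.
by move=> ?; apply: False_ind; lra.
Qed.

Let ring_uniq a x y z A B C : hat a x y z A B C -> uniq [:: a; z; B; C; y].
Proof.
move=> /hat_uniq /=; rewrite !inE !negb_or.
case/and3P => /and5P[ax ay az aA /andP[aB aC]] _.
case/and4P => /and4P[yz yA yB yC] /and3P[zA zB zC] _ /andP[BC _].
by rewrite az aB aC ay zB zC (eq_sym z) yz BC !(eq_sym _ y) yB yC.
Qed.

(** This lemma and the next two start the fan at [a], [z] and [B]; [hat_flip] gives the starts at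
    [y] and [C]. Nothing is assumed about the starting edge, so the case without any cut at [x] is
    covered too. *)
Lemma hat_cut_xa a x y z A B C : hat a x y z A B C ->
  [|| cutb x z, cutb x B, cutb x C | cutb x y].
Proof.
move=> h; apply: contraT => /norP[u1 /norP[u2 /norP[u3 u4]]].
apply: False_ind.
(* [c0] and [c1] are the coordinates of one tenth of the unrolled second copy of [x a] in the basis
   [x a], [x z], found by composing the five placements. The factor 1/10 brings the point inside the
   first triangle. *)
apply: (fan5_overlap (e := 1 / 10) (c0 := 14961 / 488410)
  (c1 := 203159 / 488410)
  (ring_uniq h) (fan_spike h) (fan_cap h) (fan_base h)
  (fan_triC (fan_cap (hat_flip h))) (fan_triC (fan_spike (hat_flip h))) u1 u2 u3 u4).
  by split; lra.
by move=> s u v0 v1 v2 v3 v4 v5; rewrite /placed; case=> ->;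
  move=> [? ?] [? ?] [? ?] [? ?] [? ?]; split; lra.
Qed.

Lemma hat_cut_xz a x y z A B C : hat a x y z A B C ->
  [|| cutb x B, cutb x C, cutb x y | cutb x a].
Proof.
move=> h; apply: contraT => /norP[u1 /norP[u2 /norP[u3 u4]]].
apply: False_ind.
apply: (fan5_overlap (e := 1 / 10) (c0 := 537275 / 16219190)
  (c1 := 54852930 / 3584440990)
  (w0 := z) _ (fan_cap h) (fan_base h)
  (fan_triC (fan_cap (hat_flip h))) (fan_triC (fan_spike (hat_flip h)))
  (fan_spike h) u1 u2 u3 u4).
- by rewrite -(rot_uniq 4); apply: (ring_uniq h).
- by split; lra.
by move=> s u v0 v1 v2 v3 v4 v5; rewrite /placed; case=> ->;
  move=> [? ?] [? ?] [? ?] [? ?] [? ?]; split; lra.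
Qed.

Lemma hat_cut_xB a x y z A B C : hat a x y z A B C ->
  [|| cutb x C, cutb x y, cutb x a | cutb x z].
Proof.
move=> h; apply: contraT => /norP[u1 /norP[u2 /norP[u3 u4]]].
apply: False_ind.
apply: (fan5_overlap (e := 1 / 10) (c0 := 83524 / 2203750)
  (c1 := 44491821 / 487028750)
  (w0 := B) _ (fan_base h)
  (fan_triC (fan_cap (hat_flip h))) (fan_triC (fan_spike (hat_flip h)))
  (fan_spike h) (fan_cap h) u1 u2 u3 u4).
- by rewrite -(rot_uniq 3); apply: (ring_uniq h).
- by split; lra.
by move=> s u v0 v1 v2 v3 v4 v5; rewrite /placed; case=> ->;
  move=> [? ?] [? ?] [? ?] [? ?] [? ?]; split; lra.
Qed.

(* Unfolding along a path [a x y z C]: the two faces [a z x] and [y A z]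
   remain joined through the faces around [x] and [y], and the edge [x a] of
   the former crosses the edge [y z] of the latter. *)
Lemma hat_path_overlap a x y z A B C : hat a x y z A B C ->
  [|| cutb x z, cutb x B, cutb x C, cutb y C | cutb y A].
Proof.
move=> h; apply: contraT => /norP[u1 /norP[u2 /norP[u3 /norP[u4 u5]]]].
have := ring_uniq h; rewrite /= !inE !negb_or.
case/and4P => /and4P[_ aB aC ay] /and3P[zB zC zy] /andP[BC By] _.
have := hat_uniq h; rewrite /= !inE !negb_or.
case/and3P => /and5P[_ _ az aA _] /and5P[_ _ xA _ _] /and4P[_ /and3P[zA _ _] _ _].
have [f1 [s [h1 hs o1 q1]]] := start (fan_spike h).
have [f2 [h2 x2 z2 o2 q2]] := step h1 (fan_cap h) aB u1 hs o1.
have [f3 [h3 x3 B3 o3 q3]] := step h2 (fan_base h) zC u2 hs o2.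
have [f4 [h4 x4 C4 o4 q4]] := step h3 (fan_triC (fan_cap (hat_flip h))) By u3 hs o3.
(* The centre of the fan moves from [x] to [y]: the face [[x C y]] is reread from [y], and a cyclic
   shift preserves the orientation. *)
have o4' : 0 < s * area2 (lpos lay f4 y) (lpos lay f4 x) (lpos lay f4 C).
  by rewrite -area2_rot.
have h4' := is_tri_rot (is_tri_rot h4).
have [f5 [h5 y5 C5 o5 q5]] := step h4' (fan_base (hat_rot h)) xA u4 hs o4'.
have [f6 [h6 y6 A6 o6 q6]] := step h5
  (fan_triC (fan_cap (hat_flip (hat_rot h)))) ltac:(by rewrite eq_sym) u5 hs o5.
rewrite y5 in q6 y6; rewrite C4 in q5; rewrite x3 x2 in q4; rewrite x2 in q3.
(* [t1], [t2] locate the crossing point on [x a] and [y z]. *)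
pose t1 := 519668240 / 2096965279; pose t2 := 730710201 / 2096965279.
apply: False_ind; apply: (no_overlap embedded lay_inj (a := 1 - t1) (b := 0) (c := t1)
  (a' := 1 - t2) (b' := 0) (c' := t2) (is_tri_swap h1) h6).
- have [xa _ _ _ _] := and5P h1.
  by apply: (is_tri_neq_mem h6).
- by rewrite /t1; split=> //; lra.
- by rewrite /t2; split=> //; lra.
all: rewrite y6 /t1 /t2; move: q1 q2 q3 q4 q5 q6; rewrite /placed; case: hs => ->;
  by move=> [? ?] [? ?] [? ?] [? ?] [? ?] [? ?]; lra.
Qed.

Definition hat_spokes x y z A B C : seq ('I_(nV S) * 'I_(nV S)) :=
  [:: (x, B); (x, C); (y, C); (y, A); (z, A); (z, B)].

Definition hat_edges a x y z A B C : seq ('I_(nV S) * 'I_(nV S)) :=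
  [:: (a, x); (a, y); (a, z); (x, y); (y, z); (z, x)] ++ hat_spokes x y z A B C.

(** All 4096 cut patterns are tried. The first premise collects the vertex conditions, the second
    has one path condition for each symmetry of the hat, and the third provides a cut that reaches a
    corner. *)
Lemma five_cuts (ax ay az xy yz zx xB xC yC yA zA zB : bool) :
  [&& [|| ax, ay | az], (1 < ax + zx + xB + xC + xy)%N,
      (1 < ay + xy + yC + yA + yz)%N & (1 < az + yz + zA + zB + zx)%N] ==>
  [&& [|| zx, xB, xC, yC | yA], [|| xy, yC, yA, zA | zB], [|| yz, zA, zB, xB | xC],
      [|| xy, xC, xB, zB | zA], [|| yz, yA, yC, xC | xB] & [|| zx, zB, zA, yA | yC]] ==>
  [|| xB, xC, yC, yA, zA | zB] ==>
  (4 < ax + ay + az + xy + yz + zx + xB + xC + yC + yA + zA + zB)%N.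
Proof.
by case: ax; case: ay; case: az; case: xy; case: yz; case: zx; case: xB; case: xC;
   case: yC; case: yA; case: zA; case: zB.
Qed.

(** For each of the five edges at [x], some other edge at [x] is cut. *)
Lemma two_cuts_x a x y z A B C : hat a x y z A B C ->
  (1 < cutb a x + cutb z x + cutb x B + cutb x C + cutb x y)%N.
Proof.
move=> h; have := hat_cut_xa h; have := hat_cut_xz h; have := hat_cut_xB h.
have := hat_cut_xz (hat_flip h); have := hat_cut_xB (hat_flip h).
rewrite (cutbC x a) (cutbC x z).
by case: (cutb a x); case: (cutb z x); case: (cutb x B); case: (cutb x C); case: (cutb x y).
Qed.

Lemma hat_cut_count a x y z A B C : hat a x y z A B C ->
  has (fun e => cutb e.1 e.2) (hat_spokes x y z A B C) ->
  (4 < count (fun e => cutb e.1 e.2) (hat_edges a x y z A B C))%N.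
Proof.
move=> h hout.
have h' := hat_rot h; have h'' := hat_rot h'.
rewrite /= !addnA addn0.
apply: (implyP (implyP (implyP (five_cuts _ _ _ _ _ _ _ _ _ _ _ _) _) _)); last first.
- by move: hout; rewrite /= orbF.
- have := hat_path_overlap h; have := hat_path_overlap h'; have := hat_path_overlap h''.
  have := hat_path_overlap (hat_flip h); have := hat_path_overlap (hat_flip h').
  have := hat_path_overlap (hat_flip h'').
  rewrite (cutbC x z) (cutbC y x) (cutbC z y).
  by do 6! [move=> ->].
- have := hat_apex_cut h; have := two_cuts_x h.
  by have := two_cuts_x h'; have := two_cuts_x h''; do 4! [move=> ->].
Qed.

End Hat.

(** * Counting cut edges *)

Lemma clos_rt_ind_prop (T : Type) (R : relation T) (P : T -> Prop) :
  (forall x y, R x y -> P x -> P y) ->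
  forall x y, clos_refl_trans T R x y -> P x -> P y.
Proof.
by move=> h x y; elim=> {x y} [x y /h //|//|x y z _ IH _ IH' /IH /IH'].
Qed.

(* Each edge merges at most two classes of faces. *)
Lemma merge_classes (T : finType) (X : eqType) (P : X -> T -> bool) (es : seq X) :
  {in es, forall e, exists f g, forall h, P e h -> h = f \/ h = g} ->
  exists c : T -> T, {in es, forall e f g, P e f -> P e g -> c f = c g} /\
    #|T| <= #|codom c| + size es.
Proof.
elim: es => [|e es IH] hP.
  exists id; split=> //; rewrite addn0 -{1}(card_codom (f := @id T)) //.
have [|c [hc hcard]] := IH.
  by move=> e' he'; apply: hP; rewrite inE he' orbT.
have [f [g hfg]] := hP e (mem_head _ _).
(* The class of [f] is merged into that of [g]; only the value [c f] can disappear from the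
   codomain. *)
pose c' h := if c h == c f then c g else c h.
exists c'; split.
  move=> e'; rewrite inE => /orP[/eqP->|he'] h k hh hk; rewrite /c'.
    have eg : (if c g == c f then c g else c g) = c g by case: ifP.
    by case: (hfg _ hh) => ->; case: (hfg _ hk) => ->; rewrite ?eqxx ?eg.
  by rewrite (hc _ he' _ _ hh hk).
have : #|codom c| <= #|codom c'|.+1.
  apply: leq_trans (_ : #|[predU1 c f & codom c']| <= _).
    apply: subset_leq_card; apply/subsetP=> y /codomP[h ->]; rewrite !inE.
    case: eqP => //= /eqP ne; apply/codomP; exists h.
    by rewrite /c' (negbTE ne).
  by rewrite cardU1; case: (_ \notin _); rewrite ?add1n ?add0n.
move=> h; apply: leq_trans hcard _; rewrite /= addnS -addSn.
by rewrite leq_add2r.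
Qed.

Section Cuts.
Variables (S : tri_surface) (cut : 'I_(nV S) -> 'I_(nV S) -> bool).
Implicit Types (u v w a x y z A B C : 'I_(nV S)).

(** The uncut edges connect all faces, and a connected graph on [nF S] nodes has at least [nF S - 1]
    edges. In terms of [merge_classes], the class map is constant. *)
Lemma uncut_count (es : seq ('I_(nV S) * 'I_(nV S))) :
  {in es, forall e, exists f g : 'I_(nF S), forall h,
     in_face e.1 h && in_face e.2 h -> h = f \/ h = g} ->
  (forall u v, is_edge u v -> (u, v) \in es \/ (v, u) \in es) ->
  (forall f g, clos_refl_trans _ (glued cut) f g) ->
  nF S <= (count (fun e => ~~ cutb cut e.1 e.2) es).+1.
Proof.
move=> h2 hes conn; rewrite -size_filter.
set es' := [seq e <- es | _].
have h2' : {in es', forall e, exists f g : 'I_(nF S), forall h,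
     in_face e.1 h && in_face e.2 h -> h = f \/ h = g}.
  by move=> e; rewrite mem_filter => /andP[_]; apply: h2.
have [c [hc hcard]] := merge_classes h2'; rewrite card_ord in hcard.
apply: leq_trans hcard _; rewrite -add1n leq_add2r.
have cE f g : c f = c g.
  apply: (clos_rt_ind_prop (P := fun h => c f = c h)) (conn f g) erefl.
  move=> {}g h [u [v [[euv nuv] [gu [gv [hu hv]]]]]] ->.
  case: (hes _ _ euv) => ein.
    by apply: (hc (u, v)); rewrite ?gu ?hu ?mem_filter ?ein ?andbT.
  by apply: (hc (v, u)); rewrite ?gv ?hv ?mem_filter ?ein ?andbT //= cutbC.
by apply/card_le1_eqP => _ _ /codomP[f ->] /codomP[g ->].
Qed.

(** A path of cuts from the apex to a vertex outside the core [a x y z] has to leave the core, and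
    spokes are the only edges that do. *)
Lemma hat_spoke_cut a x y z A B C :
  hat a x y z A B C ->
  [|| cutb cut a x, cutb cut a y | cutb cut a z] ->
  (forall u v, is_edge u v -> u \in [:: a; x; y; z] ->
     v \in [:: a; x; y; z] \/ (u, v) \in hat_spokes x y z A B C) ->
  (forall u v u' v', is_cut cut u v -> is_cut cut u' v' ->
     clos_refl_trans _ (is_cut cut) u u') ->
  (exists u v, is_cut cut u v /\ u \notin [:: a; x; y; z]) ->
  has (fun e => cutb cut e.1 e.2) (hat_spokes x y z A B C).
Proof.
move=> h hcut hnb conn [u [v [huv hu]]].
have [w hw] : exists w, is_cut cut a w.
  case/or3P: hcut => hc; [exists x | exists y | exists z].
  - exact: tri_cut (hat_axy h) hc.
  - exact: tri_cut (hat_ayz h) hc.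
  - exact: tri_cut (hat_azx h) hc.
case: hasP => // no; have := conn _ _ _ _ hw huv.
move/(clos_rt_ind_prop (P := fun t => t \in [:: a; x; y; z]))=> /(_ _ (mem_head _ _)).
move=> {}hu'; apply: contraNT hu => _; apply: hu' => s t [est cst] hs.
case: (hnb _ _ est hs) => // hst; case: no; exists (s, t) => //.
Qed.

End Cuts.

(** * The spiked tetrahedron *)

Lemma allIP (n : nat) (p : pred nat) : all p (iota 0 n) -> forall i, i < n -> p i.
Proof. by move/allP=> h i hi; apply: h; rewrite mem_iota. Qed.

Lemma allIP2 (n m : nat) (p : rel nat) :
  all (fun i => all (p i) (iota 0 m)) (iota 0 n) ->
  forall i j, i < n -> j < m -> p i j.
Proof. by move/allIP=> h i j /h /allIP; apply. Qed.

Lemma has_ex (T : Type) (p : pred T) (s : seq T) : has p s -> exists x, p x.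
Proof. by elim: s => //= x s IH /orP[|/IH //]; exists x. Qed.

(** Breadth-first search from [r] in [k] rounds, a computable witness for [clos_refl_trans]. *)
Definition reach (e : rel nat) (n k r : nat) : seq nat :=
  iter k (fun s => [seq v <- iota 0 n | (v \in s) || has (e^~ v) s]) [:: r].

Lemma reachP (n k : nat) (e : rel nat) (R : relation 'I_n) (r v : 'I_n) :
  (forall u w : 'I_n, e u w -> R u w) -> (v : nat) \in reach e n k r ->
  clos_refl_trans _ R r v.
Proof.
move=> eR; elim: k v => [|k IH] v /=.
  by rewrite inE => /eqP/val_inj ->; apply: rt_refl.
rewrite mem_filter => /andP[/orP[/IH //|/hasP[u hu euv]] _].
have un : u < n.
  case: k {IH} hu => [|k]; first by rewrite inE => /eqP ->.
  by rewrite /= mem_filter mem_iota => /and3P[].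
by apply: (rt_trans _ _ _ (Ordinal un)); [apply: IH | apply: rt_step; apply: eR].
Qed.

(** Replaces a cardinality of ordinal pairs by a sum over naturals that [vm_compute] can
    evaluate. *)
Lemma card_rel (n : nat) (p : rel nat) :
  #|[set x : 'I_n * 'I_n | p x.1 x.2]| = \sum_(0 <= i < n) \sum_(0 <= j < n) p i j.
Proof.
rewrite -sum1_card (eq_bigl (fun x : 'I_n * 'I_n => p x.1 x.2)); last first.
  by move=> x; rewrite inE.
rewrite big_mkcond big_mkord.
rewrite -(pair_bigA _ (fun i j : 'I_n => if p i j then 1 else 0)) /=.
by apply: eq_bigr => i _; rewrite big_mkord; apply: eq_bigr => j _; case: (p i j).
Qed.

(** * Separating planes *)

Section Separation.
Local Open Scope R_scope.

(** A common point of both triangles lies on the plane [dot3 n _ = c], so a vertex strictly above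
    the plane carries no weight. *)
Lemma separation (n : pt3) (c : R) (p q : 'I_3 -> pt3) (wt wt' : 'I_3 -> R) i :
  bary wt -> bary wt' -> (forall j, c <= dot3 n (p j)) ->
  (forall j, dot3 n (q j) <= c) -> comb3 wt p = comb3 wt' q ->
  c < dot3 n (p i) -> wt i = 0.
Proof.
move=> [a0 [a1 [a2 a]]] [b0 [b1 [b2 b]]] hp hq e.
have ed : dot3 n (comb3 wt p) = dot3 n (comb3 wt' q) by rewrite e.
have e' : wt i0 * (dot3 n (p i0) - c) + wt i1 * (dot3 n (p i1) - c)
        + wt i2 * (dot3 n (p i2) - c) =
          wt' i0 * (dot3 n (q i0) - c) + wt' i1 * (dot3 n (q i1) - c)
        + wt' i2 * (dot3 n (q i2) - c).
  suff: dot3 n (comb3 wt p) - c * (wt i0 + wt i1 + wt i2) =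
        dot3 n (comb3 wt' q) - c * (wt' i0 + wt' i1 + wt' i2).
    by rewrite /dot3 /comb3 /= => h; lra.
  by rewrite ed a b.
have m (x y : R) : 0 <= x -> 0 <= y -> 0 <= x * y by exact: Rmult_le_pos.
have p0 := m _ _ a0 (Rge_le _ _ (Rge_minus _ _ (Rle_ge _ _ (hp i0)))).
have p1 := m _ _ a1 (Rge_le _ _ (Rge_minus _ _ (Rle_ge _ _ (hp i1)))).
have p2 := m _ _ a2 (Rge_le _ _ (Rge_minus _ _ (Rle_ge _ _ (hp i2)))).
have q0 : wt' i0 * (dot3 n (q i0) - c) <= 0 by have := hq i0; nra.
have q1 : wt' i1 * (dot3 n (q i1) - c) <= 0 by have := hq i1; nra.
have q2 : wt' i2 * (dot3 n (q i2) - c) <= 0 by have := hq i2; nra.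
move=> hi; have : wt i * (dot3 n (p i) - c) = 0.
  by case: (ord3P i) => ->; lra.
by case/Rmult_integral => //; lra.
Qed.

End Separation.

(** * Integer coordinates and tables for exact computation *)

Definition zpt := (Z * Z * Z)%type.
Definition zsub (a b : zpt) : zpt :=
  (a.1.1 - b.1.1, a.1.2 - b.1.2, a.2 - b.2)%Z.
Definition zdot (a b : zpt) : Z := (a.1.1 * b.1.1 + a.1.2 * b.1.2 + a.2 * b.2)%Z.
Definition zcross (a b : zpt) : zpt :=
  (a.1.2 * b.2 - a.2 * b.1.2, a.2 * b.1.1 - a.1.1 * b.2,
   a.1.1 * b.1.2 - a.1.2 * b.1.1)%Z.

Definition toR3 (a : zpt) : pt3 := Pt3 (IZR a.1.1) (IZR a.1.2) (IZR a.2).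

Lemma toR3_sub a b : sub3 (toR3 a) (toR3 b) = toR3 (zsub a b).
Proof. by rewrite /sub3 /toR3 /= !minus_IZR. Qed.

Lemma toR3_dot a b : dot3 (toR3 a) (toR3 b) = IZR (zdot a b).
Proof. by rewrite /dot3 /toR3 /zdot !plus_IZR !mult_IZR. Qed.

Lemma toR3_cross a b : cross3 (toR3 a) (toR3 b) = toR3 (zcross a b).
Proof. by rewrite /cross3 /toR3 /= !minus_IZR !mult_IZR. Qed.

Lemma toR3_inj : injective toR3.
Proof. by case=> [[a b] c] [[a' b'] c'] [] /eq_IZR /= -> /eq_IZR /= -> /eq_IZR /= ->. Qed.

(* The coordinates are chosen so that the three kinds of triangles have areas
   rational relative to their squared sides; all coordinates of a layout are then
   rational once one edge is placed.
   Vertices 0-3 are the corners of a regular tetrahedron, 4-7 the apexes of the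
   four spikes and 8-19 the vertices of their bases. *)
Definition vtab : seq zpt :=
  [:: (125, 125, 125); (125, -125, -125); (-125, 125, -125); (-125, -125, 125);
      (-247, -247, -247); (-247, 247, 247); (247, -247, 247); (247, 247, -247);
      (-157, -127, -127); (-127, -157, -127); (-127, -127, -157);
      (-157, 127, 127); (-127, 157, 127); (-127, 127, 157);
      (157, -127, 127); (127, -157, 127); (127, -127, 157);
      (157, 127, -127); (127, 157, -127); (127, 127, -157)]%Z.

(* Each row lists the labels [a x y z A B C] of a hat. *)
Definition hattab : seq (seq nat) :=
  [:: [:: 4; 8; 9; 10; 1; 2; 3]; [:: 5; 11; 12; 13; 0; 3; 2];
      [:: 6; 14; 15; 16; 3; 0; 1]; [:: 7; 17; 18; 19; 2; 1; 0]].

Definition hat_faces (l : seq nat) : seq (seq nat) :=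
  if l is [:: a; x; y; z; A; B; C] then
    [:: [:: a; x; y]; [:: a; y; z]; [:: a; z; x]; [:: z; x; B]; [:: x; B; C];
        [:: x; C; y]; [:: y; C; A]; [:: y; A; z]; [:: z; A; B]]
  else [::].

Definition ftab : seq (seq nat) := Eval vm_compute in flatten (map hat_faces hattab).

Definition vt (v : nat) : zpt := nth (0, 0, 0)%Z vtab v.
Definition fv (f i : nat) : nat := nth 0 (nth [::] ftab f) i.
Definition fmem (v f : nat) : bool := v \in nth [::] ftab f.

Definition nedge (u v : nat) : bool :=
  (u != v) && has (fun f => fmem u f && fmem v f) (iota 0 36).

Definition znormal (f : nat) : zpt :=
  zcross (zsub (vt (fv f 1)) (vt (fv f 0))) (zsub (vt (fv f 2)) (vt (fv f 0))).

(* Besides the plane of [g], planes with normals in {-1,0,1}^3 suffice. *)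
Definition directions (g : nat) : seq zpt :=
  znormal g :: zsub (0, 0, 0)%Z (znormal g) ::
  [seq (p.1, p.2, c) | p <- [seq (a, b) | a <- [:: -1; 0; 1]%Z, b <- [:: -1; 0; 1]%Z],
                      c <- [:: -1; 0; 1]%Z].

(** Vertices shared with [g] may lie on the plane; the others must be strictly above it, since these
    are the ones whose weight must vanish. *)
Definition separates (f g : nat) (n : zpt) : bool :=
  let h k i := zdot n (vt (fv k i)) in
  let c := Z.max (h g 0) (Z.max (h g 1) (h g 2)) in
  all (fun i => if fmem (fv f i) g then (c <=? h f i)%Z else (c <? h f i)%Z) (iota 0 3).

Lemma fv_lt_check : all (fun f => all (fun i => fv f i < 20) (iota 0 3)) (iota 0 36).
Proof. by vm_compute. Qed.

Lemma fv_lt (f : 'I_36) (i : 'I_3) : fv f i < 20.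
Proof. exact (allIP2 fv_lt_check (ltn_ord f) (ltn_ord i)). Qed.

Definition spiked : tri_surface :=
  @TriSurface 20 36 (fun v => toR3 (vt v)) (fun f i => Ordinal (fv_lt f i)).

Lemma face_size_check : all (fun f => size (nth [::] ftab f) == 3) (iota 0 36).
Proof. by vm_compute. Qed.

Lemma in_faceE (v : 'I_(nV spiked)) (f : 'I_(nF spiked)) : in_face v f = fmem v f.
Proof.
have /eqP sz := allIP face_size_check (ltn_ord f).
apply/existsP/idP=> [[i /eqP <-]|].
  by rewrite /fmem mem_nth // sz ltn_ord.
move/(nthP 0)=> [i]; rewrite sz => hi e.
by exists (Ordinal hi); rewrite -val_eqE /=; apply/eqP.
Qed.

Lemma is_edgeE (u v : 'I_(nV spiked)) : is_edge u v = nedge u v.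
Proof.
rewrite /is_edge /nedge -val_eqE; congr (_ && _).
apply/existsP/hasP=> [[f]|[f]].
  by rewrite !in_faceE => h; exists (f : nat); rewrite // mem_iota ltn_ord.
by rewrite mem_iota => /andP[_ hf] h; exists (Ordinal hf); rewrite !in_faceE.
Qed.

Lemma fposE (f : 'I_(nF spiked)) i : fpos f i = toR3 (vt (fv f i)).
Proof. by []. Qed.

Lemma face_normalE (f : 'I_(nF spiked)) : face_normal f = toR3 (znormal f).
Proof. by rewrite /face_normal !fposE !toR3_sub toR3_cross. Qed.

Lemma separatesP (f g : 'I_(nF spiked)) n (wt wt' : 'I_3 -> R) i :
  separates f g n -> bary wt -> bary wt' ->
  comb3 wt (fpos f) = comb3 wt' (fpos g) -> ~~ in_face (fvert f i) g -> wt i = IZR 0.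
Proof.
rewrite /separates; set c := Z.max _ _ => /allIP h hb hb' e; rewrite in_faceE => hi.
apply: (separation (n := toR3 n) (c := IZR c) hb hb' _ _ e) => [j|j|].
- rewrite fposE toR3_dot; apply: IZR_le; have := h _ (ltn_ord j).
  by case: ifP => _; [move/Z.leb_le | move/Z.ltb_lt; lia].
- rewrite fposE toR3_dot; apply: IZR_le; rewrite /c.
  by case: (ord3P j) => -> /=; lia.
- rewrite fposE toR3_dot; apply: IZR_lt; have := h _ (ltn_ord i).
  by rewrite (negbTE hi) => /Z.ltb_lt.
Qed.

Lemma embedded_check : all (fun f : nat => all (fun g : nat =>
  (f == g) || has (separates f g) (directions g)) (iota 0 36)) (iota 0 36).
Proof. by vm_compute. Qed.

Lemma spiked_embedded (f g : 'I_(nF spiked)) (wt wt' : 'I_3 -> R) :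
  f <> g -> bary wt -> bary wt' ->
  comb3 wt (fpos f) = comb3 wt' (fpos g) ->
  forall i, ~~ in_face (fvert f i) g -> wt i = IZR 0.
Proof.
move=> fg hb hb' e i.
have /orP[/eqP fg'|/has_ex[n hn]] := allIP2 embedded_check (ltn_ord f) (ltn_ord g).
  by case: fg; apply: val_inj.
exact: separatesP hn hb hb' e.
Qed.

(** * Edges, coplanarity, vertex links and 3-connectivity *)

Definition edge_faces (u v : nat) : seq nat :=
  [seq k <- iota 0 36 | fmem u k && fmem v k].

Lemma edge_faces_check : all (fun u : nat => all (fun v : nat => nedge u v ==>
  (size (edge_faces u v) == 2)) (iota 0 20)) (iota 0 20).
Proof. by vm_compute. Qed.

Lemma spiked_edge_faces (u v : 'I_(nV spiked)) : is_edge u v ->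
  exists f g : 'I_(nF spiked), f <> g /\ in_face u f /\ in_face v f /\
    in_face u g /\ in_face v g /\
    forall h, in_face u h -> in_face v h -> h = f \/ h = g.
Proof.
have := allIP2 edge_faces_check (ltn_ord u) (ltn_ord v).
rewrite is_edgeE => /implyP h1 /h1 sz.
have hfs k : (k \in edge_faces u v) = [&& fmem u k, fmem v k & k < 36].
  by rewrite mem_filter mem_iota /= add0n andbA.
have : uniq (edge_faces u v) by rewrite filter_uniq ?iota_uniq.
case: (edge_faces u v) sz hfs => [|f [|g [|]]] // _ hfs /=; rewrite andbT inE => fg.
have := hfs f; have := hfs g; rewrite !inE !eqxx orbT => /esym/and3P[ug vg hg].
move=> /esym/and3P[uf vf hf]; exists (Ordinal hf), (Ordinal hg).
split; first by case=> e; rewrite e eqxx in fg.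
split; first by rewrite in_faceE; exact: uf.
split; first by rewrite in_faceE; exact: vf.
split; first by rewrite in_faceE; exact: ug.
split; first by rewrite in_faceE; exact: vg.
move=> k; rewrite !in_faceE => uk vk.
have := hfs k; rewrite uk vk ltn_ord !inE => /orP[]/eqP e; [left|right]; exact: val_inj.
Qed.

(** The shared edge is given by its corner indices [p] and [q] in [f], which range over 3 values
    instead of 20. *)
Definition coplanar_ok (f g p q i : nat) : bool :=
  [|| f == g, fv f p == fv f q, ~~ fmem (fv f p) g, ~~ fmem (fv f q) g,
      fmem (fv g i) f
    | ~~ (zdot (znormal f) (zsub (vt (fv g i)) (vt (fv f 0))) =? 0)%Z].

Lemma coplanar_check : all (fun f => all (fun g => all (fun p => all (fun q =>
  all (coplanar_ok f g p q) (iota 0 3)) (iota 0 3)) (iota 0 3)) (iota 0 36)) (iota 0 36).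
Proof. by vm_compute. Qed.

Lemma spiked_not_coplanar (f g : 'I_(nF spiked)) i :
  f <> g -> ~~ in_face (fvert g i) f ->
  (exists u v : 'I_(nV spiked),
     u <> v /\ in_face u f /\ in_face v f /\ in_face u g /\ in_face v g) ->
  dot3 (face_normal f) (sub3 (fpos g i) (fpos f i0)) <> IZR 0.
Proof.
move=> fg; rewrite in_faceE => hi [u [v [uv [uf [vf [ug vg]]]]]].
have := allIP2 (allIP2 coplanar_check (ltn_ord f) (ltn_ord g))
  (ltn_ord (corner f u)) (ltn_ord (corner f v)).
move/allIP/(_ _ (ltn_ord i)).
have eu : fv f (corner f u) = u := congr1 val (cornerK uf).
have ev : fv f (corner f v) = v := congr1 val (cornerK vf).
rewrite in_faceE in ug; rewrite in_faceE in vg.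
rewrite /coplanar_ok eu ev ug vg (negbTE hi) => /or3P[/eqP e|/eqP e|/negP hz].
- by case: fg; apply: val_inj.
- by case: uv; apply: val_inj.
- rewrite face_normalE !fposE toR3_sub toR3_dot => /eq_IZR e.
  by apply: hz; apply/Z.eqb_eq.
Qed.

Definition link_rel (v h k : nat) : bool :=
  [&& fmem v h, fmem v k & has (fun u => (u != v) && fmem u k) (nth [::] ftab h)].

(** Four rounds suffice: at most nine faces meet at a vertex, and the search goes around the link
    both ways. *)
Lemma link_check : all (fun v : nat => all (fun f : nat => fmem v f ==>
  let r := reach (link_rel v) 36 4 f in all (fun g => fmem v g ==> (g \in r)) (iota 0 36))
  (iota 0 36)) (iota 0 20).
Proof. by vm_compute. Qed.

Lemma ftab_lt_check : all (fun k => all (fun u => u < 20) (nth [::] ftab k)) (iota 0 36).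
Proof. by vm_compute. Qed.

Lemma spiked_link (v : 'I_(nV spiked)) (f g : 'I_(nF spiked)) :
  in_face v f -> in_face v g ->
  clos_refl_trans _ (fun h k => in_face v h /\ in_face v k /\
                      exists u, u <> v /\ in_face u h /\ in_face u k) f g.
Proof.
rewrite !in_faceE => vf vg.
have := allIP2 link_check (ltn_ord v) (ltn_ord f); rewrite vf => H.
have := allIP H (ltn_ord g); rewrite vg {H}; apply: reachP => h k.
rewrite !in_faceE => /and3P[vh vk /hasP[u uh /andP[uv uk]]].
have hu : u < 20 by apply: (allP (allIP ftab_lt_check (ltn_ord h))).
split; first exact: vh.
split; first exact: vk.
exists (Ordinal hu); rewrite !in_faceE; split; last by split; [exact: uh | exact: uk].
by move=> e'; rewrite -e' eqxx in uv.
Qed.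

(** Tabulated once, because [connected_check] runs a search for each of 400 pairs. *)
Definition neighbours : seq (seq nat) :=
  Eval vm_compute in [seq [seq v <- iota 0 20 | nedge u v] | u <- iota 0 20].

Lemma neighbours_check :
  all (fun u : nat => all (nedge u) (nth [::] neighbours u)) (iota 0 20).
Proof. by vm_compute. Qed.

Definition avoiding_rel (a b u v : nat) : bool :=
  [&& v \in nth [::] neighbours u, u != a, u != b, v != a & v != b].

(** One of the corners 0, 1, 2 always survives the removal of [a] and [b]. *)
Definition root (a b : nat) : nat :=
  head 0 [seq k <- iota 0 3 | (k != a) && (k != b)].

Lemma connected_check : all (fun a : nat => all (fun b : nat => (root a b < 20) &&
  let r := reach (avoiding_rel a b) 20 5 (root a b) in
  all (fun v : nat => [|| v == a, v == b | v \in r])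
  (iota 0 20)) (iota 0 20)) (iota 0 20).
Proof. by vm_compute. Qed.

Lemma spiked_3connected (a b : 'I_(nV spiked)) : @connected_avoiding spiked a b.
Proof.
have /andP[hr H] := allIP2 connected_check (ltn_ord a) (ltn_ord b).
pose R (x y : 'I_(nV spiked)) := is_edge x y /\ x <> a /\ x <> b /\ y <> a /\ y <> b.
have Rsym x y : clos_refl_trans _ R x y -> clos_refl_trans _ R y x.
  elim=> {x y} [x y [xy [xa [xb [ya yb]]]]|x|x y z _ yx _ zy].
  - apply: rt_step; split=> //; move: xy; rewrite /is_edge eq_sym.
    by case/andP=> -> /existsP[f fxy]; apply/existsP; exists f; rewrite andbC.
  - exact: rt_refl.
  - exact: rt_trans zy yx.
have hub v : v <> a -> v <> b -> clos_refl_trans _ R (Ordinal hr) v.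
  move=> va vb; have /or3P[/eqP va'|/eqP vb'|] := allIP H (ltn_ord v).
  - by case: va; apply: val_inj.
  - by case: vb; apply: val_inj.
  clear H; apply: (@reachP 20 5 (avoiding_rel a b) R (Ordinal hr) v) => x y.
  rewrite /R is_edgeE; case/and5P=> xy /eqP xa /eqP xb /eqP ya /eqP yb.
  have := allIP neighbours_check (ltn_ord x) => /allP/(_ _ xy) ->.
  by do 4! [split; first by [|move/(congr1 val)]]; move/(congr1 val).
by move=> u v ua ub va vb; apply: rt_trans (Rsym _ _ (hub u ua ub)) (hub v va vb).
Qed.

Lemma vpos_check : all (fun u : nat => all (fun v : nat => (u == v) ||
  let d := zsub (vt u) (vt v) in ~~ (zdot d d =? 0)%Z) (iota 0 20)) (iota 0 20).
Proof. by vm_compute. Qed.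

Lemma face_uniq_check :
  all (fun k => uniq (nth [::] ftab k) && (size (nth [::] ftab k) == 3))
  (iota 0 36).
Proof. by vm_compute. Qed.

Lemma normal_check : all (fun k => ~~ (zdot (znormal k) (znormal k) =? 0)%Z) (iota 0 36).
Proof. by vm_compute. Qed.

Lemma face_inj_check : all (fun k : nat => all (fun l : nat =>
  all (fun v => fmem v k == fmem v l) (iota 0 20) ==> (k == l))
  (iota 0 36)) (iota 0 36).
Proof. by vm_compute. Qed.

Lemma cover_check : all (fun v => has (fmem v) (iota 0 36)) (iota 0 20).
Proof. by vm_compute. Qed.

Definition upper_edge (u v : nat) : bool := (u < v) && nedge u v.

Lemma num_edges_check : \sum_(0 <= u < 20) \sum_(0 <= v < 20) upper_edge u v = 54.
Proof. by rewrite unlock; vm_compute. Qed.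

Lemma spiked_num_edges : num_edges spiked = 54.
Proof.
rewrite -num_edges_check -card_rel; apply: eq_card => x.
by rewrite !inE is_edgeE.
Qed.

Lemma spiked_topologically_convex : topologically_convex spiked.
Proof.
split.
  move=> u v /toR3_inj e; have := allIP2 vpos_check (ltn_ord u) (ltn_ord v).
  case/orP=> [/eqP|]; [exact: val_inj | rewrite e].
  by rewrite /zdot /zsub /= !Z.sub_diag.
split.
  move=> f i j [] /eqP; have /andP[hu /eqP hs] := allIP face_uniq_check (ltn_ord f).
  by rewrite /fv nth_uniq ?hs ?ltn_ord // => /eqP/val_inj.
split.
  move=> f; rewrite face_normalE -[Pt3 _ _ _]/(toR3 (0, 0, 0)%Z) => /toR3_inj e.
  by have := allIP normal_check (ltn_ord f); rewrite e.
split.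
  move=> f g e; apply/val_inj/eqP.
  apply: (implyP (allIP2 face_inj_check (ltn_ord f) (ltn_ord g))).
  apply/allP=> v; rewrite mem_iota => /andP[_ hv].
  by have := e (Ordinal hv); rewrite !in_faceE => /= ->.
split.
  move=> v; have /hasP[f] := allIP cover_check (ltn_ord v).
  by rewrite mem_iota => /andP[_ hf] vf; exists (Ordinal hf); rewrite in_faceE.
split; first exact: spiked_edge_faces.
split; first exact: spiked_embedded.
split; first exact: spiked_not_coplanar.
split; first exact: spiked_link.
split; last by split=> //; exact: spiked_3connected.
by rewrite spiked_num_edges.
Qed.

(** For [j = k] this is a squared side length, so it serves both the isosceles and the acuteness
    test. *)
Definition corner_dot (f i j k : nat) : Z :=
  zdot (zsub (vt (fv f j)) (vt (fv f i))) (zsub (vt (fv f k)) (vt (fv f i))).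

Lemma acute_check : all (fun f : nat =>
  [&& [|| corner_dot f 1 0 0 =? corner_dot f 2 0 0,
          corner_dot f 0 1 1 =? corner_dot f 2 1 1
        | corner_dot f 0 2 2 =? corner_dot f 1 2 2],
      0 <? corner_dot f 0 1 2, 0 <? corner_dot f 1 0 2
    & 0 <? corner_dot f 2 0 1]%Z) (iota 0 36).
Proof. by vm_compute. Qed.

Lemma spiked_acute_isosceles (f : 'I_(nF spiked)) : acute_isosceles f.
Proof.
have /and4P[iso h0 h1 h2] := allIP acute_check (ltn_ord f).
rewrite /acute_isosceles /dist3sq !fposE !toR3_sub !toR3_dot.
split; last by do !split; apply: IZR_lt; apply/Z.ltb_lt.
by case/or3P: iso => /Z.eqb_eq e; [left | right; left | right; right]; congr IZR.
Qed.

(** * Unfoldings of the spiked tetrahedron *)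

Definition vert (n : nat) : 'I_(nV spiked) := @inord 19 n.

Lemma vertK n : n < 20 -> vert n = n :> nat.
Proof. exact: inordK. Qed.

Lemma vert_val (v : 'I_(nV spiked)) : vert v = v.
Proof. exact: inord_val. Qed.

Definition lab (k i : nat) : nat := nth 0 (nth [::] hattab k) i.

Definition ntri (u v w : nat) : bool :=
  [&& u < 20, v < 20, w < 20, u != v, v != w, u != w &
      has (fun f => [&& fmem u f, fmem v f & fmem w f]) (iota 0 36)].

Lemma ntriP u v w : ntri u v w -> tri (vert u) (vert v) (vert w).
Proof.
case/and5P=> hu hv hw uv /and3P[vw uw /hasP[f]].
rewrite mem_iota => /andP[_ hf] /and3P[uf vf wf]; exists (Ordinal hf).
by rewrite /is_tri -!val_eqE !in_faceE /= !vertK // uv vw uw uf vf wf.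
Qed.

Definition nsqd (u v : nat) (d : Z) : bool :=
  [&& u < 20, v < 20 & (let w := zsub (vt u) (vt v) in zdot w w =? d)%Z].

Lemma nsqdP u v d : nsqd u v d -> sqd (vert u) (vert v) = IZR d.
Proof.
case/and3P=> hu hv /Z.eqb_eq <-.
by rewrite /sqd /dist3sq /= !vertK // toR3_sub toR3_dot.
Qed.

Lemma vert_uniq (l : seq nat) : uniq l -> all (fun n => n < 20) l -> uniq (map vert l).
Proof.
move=> ul /allP hl; rewrite map_inj_in_uniq // => u v /hl hu /hl hv.
by move/(congr1 val); rewrite /= !vertK.
Qed.

Lemma hat_lab k : k < 4 ->
  hat (vert (lab k 0)) (vert (lab k 1)) (vert (lab k 2)) (vert (lab k 3))
      (vert (lab k 4)) (vert (lab k 5)) (vert (lab k 6)).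
Proof.
case: k => [|[|[|[|//]]]] _; split;
  try (by apply: ntriP; vm_compute); try (by apply: nsqdP; vm_compute);
  by apply: (vert_uniq (l := [:: _; _; _; _; _; _; _])); vm_compute.
Qed.

Definition base_edges : seq ('I_(nV spiked) * 'I_(nV spiked)) :=
  [seq (vert e.1, vert e.2) | e <- [:: (0, 1); (0, 2); (0, 3); (1, 2); (1, 3); (2, 3)]].

Definition hat_edges_lab k : seq ('I_(nV spiked) * 'I_(nV spiked)) :=
  hat_edges (vert (lab k 0)) (vert (lab k 1)) (vert (lab k 2)) (vert (lab k 3))
      (vert (lab k 4)) (vert (lab k 5)) (vert (lab k 6)).

Definition edges : seq ('I_(nV spiked) * 'I_(nV spiked)) :=
  base_edges ++ flatten [seq hat_edges_lab k | k <- [:: 0; 1; 2; 3]].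

(** The numbers are positions in the row [[a x y z A B C]], in the order of [hat_spokes]. *)
Definition nspokes (k : nat) : seq (nat * nat) :=
  [seq (lab k e.1, lab k e.2) | e <- [:: (1, 5); (1, 6); (2, 6); (2, 4); (3, 4); (3, 5)]].

Definition nedges : seq (nat * nat) :=
  [:: (0, 1); (0, 2); (0, 3); (1, 2); (1, 3); (2, 3)] ++
  flatten [seq [seq (lab k e.1, lab k e.2) |
                 e <- [:: (0, 1); (0, 2); (0, 3); (1, 2); (2, 3); (3, 1)]] ++ nspokes k
          | k <- [:: 0; 1; 2; 3]].

Lemma edgesE : edges = [seq (vert e.1, vert e.2) | e <- nedges].
Proof. by []. Qed.

Lemma nedges_check : all (fun u => all (fun v => nedge u v ==>
  ((u, v) \in nedges) || ((v, u) \in nedges)) (iota 0 20)) (iota 0 20).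
Proof. by vm_compute. Qed.

Lemma nedges_nedge : all (fun e => [&& e.1 < 20, e.2 < 20 & nedge e.1 e.2]) nedges.
Proof. by vm_compute. Qed.

(** The first four labels of a row are the core [a x y z]. *)
Lemma hat_star_check : all (fun k => all (fun u => all (fun v => nedge u v ==>
  (u \in take 4 (nth [::] hattab k)) ==>
  ((v \in take 4 (nth [::] hattab k)) || ((u, v) \in nspokes k))) (iota 0 20))
  (iota 0 20)) (iota 0 4).
Proof. by vm_compute. Qed.

Lemma hat_core k (v : 'I_(nV spiked)) : k < 4 ->
  (v \in [:: vert (lab k 0); vert (lab k 1); vert (lab k 2); vert (lab k 3)]) =
  ((v : nat) \in take 4 (nth [::] hattab k)).
Proof.
by case: k => [|[|[|[|//]]]] _; rewrite !inE -!val_eqE /= !inordK.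
Qed.

Section SpikedUnfolding.
Variables (cut : 'I_(nV spiked) -> 'I_(nV spiked) -> bool)
          (lay : 'I_(nF spiked) -> 'I_3 -> pt2).
Hypothesis unfolding : one_piece_edge_unfolding cut lay.

Let cutp (e : 'I_(nV spiked) * 'I_(nV spiked)) := cutb cut e.1 e.2.

Lemma spiked_hat_cuts k : k < 4 -> 4 < count cutp (hat_edges_lab k).
Proof.
case: unfolding => _ [_ [conn [iso [glue linj]]]] hk.
have apex j (hj : j < 4) :=
  hat_apex_cut spiked_embedded iso glue linj (hat_lab hj).
apply: (hat_cut_count spiked_embedded iso glue linj (hat_lab hk)).
apply: (hat_spoke_cut (hat_lab hk) (apex _ hk) _ conn).
  move=> u v; rewrite is_edgeE !hat_core // => uv hu.
  have := allIP2 (allIP hat_star_check hk) (ltn_ord u) (ltn_ord v).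
  rewrite uv hu => /orP[|huv]; [by left | right].
  have := map_f (fun e => (vert e.1, vert e.2)) huv.
  by rewrite /= !vert_val.
(* The cut at the apex of another hat [j] starts outside the core of hat [k]. *)
pose j := if k == 0 then 1 else 0.
have hj : j < 4 by rewrite /j; case: ifP.
have [w hw] : exists w, is_cut cut (vert (lab j 0)) w.
  have h := hat_lab hj.
  case/or3P: (apex _ hj) => hc.
  - exists (vert (lab j 1)); exact: tri_cut (hat_axy h) hc.
  - exists (vert (lab j 2)); exact: tri_cut (hat_ayz h) hc.
  - exists (vert (lab j 3)); exact: tri_cut (hat_azx h) hc.
exists (vert (lab j 0)), w; split=> //; rewrite hat_core //.
by rewrite /j; move: hk; clear; case: k => [|[|[|[|//]]]] _; rewrite vertK.
Qed.

Lemma spiked_no_unfolding : False.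
Proof.
have two : {in edges, forall e, exists f g : 'I_(nF spiked), forall h,
    in_face e.1 h && in_face e.2 h -> h = f \/ h = g}.
  move=> e; rewrite edgesE => /mapP[d /(allP nedges_nedge)/and3P[h1 h2 h12] ->] /=.
  have e12 : is_edge (vert d.1) (vert d.2) by rewrite is_edgeE !vertK.
  have [f [g [_ [_ [_ [_ [_ fg]]]]]]] := spiked_edge_faces e12.
  by exists f, g => h /andP[hu hv]; apply: fg.
have all_edges (u v : 'I_(nV spiked)) : is_edge u v -> (u, v) \in edges \/ (v, u) \in edges.
  rewrite is_edgeE => uv; have := allIP2 nedges_check (ltn_ord u) (ltn_ord v).
  rewrite uv edgesE => /orP[] huv; [left|right];
    by have := map_f (fun e => (vert e.1, vert e.2)) huv; rewrite /= !vert_val.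
have [conn _] := unfolding.
have few : 35 <= count (fun e => ~~ cutb cut e.1 e.2) edges.
  exact: uncut_count two all_edges conn.
have total : count cutp edges + count (fun e => ~~ cutb cut e.1 e.2) edges = 54.
  by rewrite (count_predC cutp edges) edgesE size_map.
have h0 := spiked_hat_cuts (k := 0) isT; have h1 := spiked_hat_cuts (k := 1) isT.
have h2 := spiked_hat_cuts (k := 2) isT; have h3 := spiked_hat_cuts (k := 3) isT.
(* The four hats own disjoint parts of the list [edges]. With the 35 uncut edges this makes 55, more
   than the 54 available. *)
have many : 5 + 5 + (5 + 5) <= count cutp edges.
  have -> : edges = base_edges ++ (hat_edges_lab 0 ++ hat_edges_lab 1) ++
                                  (hat_edges_lab 2 ++ hat_edges_lab 3) by [].
  rewrite (count_cat _ base_edges) count_cat (count_cat _ (hat_edges_lab 0)).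
  rewrite (count_cat _ (hat_edges_lab 2)).
  by apply: leq_trans (leq_add (leq_add h0 h1) (leq_add h2 h3)) (leq_addl _ _).
by have := leq_add many few; rewrite total.
Qed.

End SpikedUnfolding.

Theorem theorem1 :
  exists S : tri_surface,
    topologically_convex S /\
    (forall f : 'I_(nF S), acute_isosceles f) /\
    ~ has_one_piece_edge_unfolding S.
Proof.
exists spiked; split; first exact: spiked_topologically_convex.
split; first exact: spiked_acute_isosceles.
by case=> cut [lay /spiked_no_unfolding].
Qed.
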